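(* The following varieties form an infinite strictly ascending chain: $$\mathsf{V}(D_2) < \mathsf{V}(\mathbf{M}_2(D_2)) < \cdots < \mathsf{V}(\mathbf{M}_n(D_2)) < \mathsf{V}(\mathbf{M}_{n+1}(D_2)) < \cdots .$$
   Context: An ai-semiring (additively idempotent semiring) is an algebra $(S,+,\cdot)$ such that $(S,+)$ is a commutative idempotent semigroup, $(S,\cdot)$ is a semigroup, and $x(y+z)=xy+xz$, $(x+y)z=xz+yz$ hold. $D_2=\{0,1\}$ is the two-element distributive lattice viewed as an ai-semiring, with $+$ the maximum and $\cdot$ the minimum. For an ai-semiring $S$ and $n\ge 2$, $\mathbf{M}_n(S)$ is the ai-semiring of all $n\times n$ matrices over $S$ with entrywise addition and product $(AB)_{ij}=\sum_{k=1}^n A_{ik}B_{kj}$. A variety of ai-semirings is a class of ai-semirings closed under subalgebras, homomorphic images and arbitrary direct products; $\mathsf{V}(S)$ denotes the smallest variety containing $S$ (equivalently, the class of all ai-semirings satisfying every identity that holds in $S$). $\mathcal{W}<\mathcal{V}$ means that $\mathcal{W}$ is properly contained in $\mathcal{V}$. *)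

(* Defs.v *)
From HB Require Import structures.
From mathcomp Require Import all_boot matrix.
From mathcomp Require Import boolp.

Set Implicit Arguments.
Unset Strict Implicit.
Unset Printing Implicit Defensive.

Declare Scope ai_scope.
Delimit Scope ai_scope with AI.
Local Open Scope ring_scope.
Local Open Scope ai_scope.

(* The carrier is an arbitrary nonempty type: the semigroup structures of
   MathComp's nmodule.v and monoid.v are not used because they also demand
   a choiceType.  Neither a zero nor a unit is assumed. *)
HB.mixin Record isAiSemiring (T : Type) := {
  ai_add : T -> T -> T;
  ai_mul : T -> T -> T;
  ai_inhabited : inhabited T;
  ai_addA : associative ai_add;
  ai_addC : commutative ai_add;
  ai_addxx : idempotent_op ai_add;
  ai_mulA : associative ai_mul;
  ai_mulDr : right_distributive ai_mul ai_add;
  ai_mulDl : left_distributive ai_mul ai_add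
}.

#[short(type="aiSemiringType")]
HB.structure Definition AiSemiring := {T of isAiSemiring T}.

Notation "x + y" := (ai_add x y) : ai_scope.
Notation "x * y" := (ai_mul x y) : ai_scope.

Definition ai_morphism (S T : aiSemiringType) (f : S -> T) : Prop :=
  {morph f : x y / x + y} /\ {morph f : x y / x * y}.

(* On false < true the maximum is orb and the minimum is andb. *)
Definition D2 : Type := bool.

HB.instance Definition _ := isAiSemiring.Build D2
  (inhabits false) orbA orbC orbb andbA andb_orr andb_orl.

Section NonemptySum.
Variable S : aiSemiringType.

HB.instance Definition _ :=
  SemiGroup.isComLaw.Build S (@ai_add S) (@ai_addA S) (@ai_addC S).

(* Without a zero only nonempty sums make sense; the term of index 0 plays
   the part of the initial value of the iteration. *)
Definition ai_sum m (F : 'I_m.+1 -> S) : S :=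
  \big[ai_add/F ord0]_(k < m) F (lift ord0 k).

Lemma ai_sum_split (I : Type) (r : seq I) (x y : S) (F G : I -> S) :
  \big[ai_add/x + y]_(i <- r) (F i + G i) =
  \big[ai_add/x]_(i <- r) F i + \big[ai_add/y]_(i <- r) G i.
Proof.
elim: r => [|i r IH]; first by rewrite !big_nil.
rewrite !big_cons IH -!ai_addA; congr (_ + _).
by rewrite !ai_addA; congr (_ + _); rewrite ai_addC.
Qed.

Lemma eq_ai_sum m (F G : 'I_m.+1 -> S) : F =1 G -> ai_sum F = ai_sum G.
Proof. by move=> FG; rewrite /ai_sum FG; apply: eq_bigr => *; apply: FG. Qed.

Lemma ai_sumDl m (F G : 'I_m.+1 -> S) :
  ai_sum (fun k => F k + G k) = ai_sum F + ai_sum G.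
Proof. exact: ai_sum_split. Qed.

Lemma ai_mul_sumr m (F : 'I_m.+1 -> S) c :
  c * ai_sum F = ai_sum (fun k => c * F k).
Proof. exact: (big_morph (ai_mul c) (ai_mulDr c)). Qed.

Lemma ai_mul_suml m (F : 'I_m.+1 -> S) c :
  ai_sum F * c = ai_sum (fun k => F k * c).
Proof.
exact: (big_morph (fun x => ai_mul x c) (fun x y => ai_mulDl x y c)).
Qed.

Lemma ai_exchange_sum m n (F : 'I_m.+1 -> 'I_n.+1 -> S) :
  ai_sum (fun i => ai_sum (F i)) = ai_sum (fun j => ai_sum (F^~ j)).
Proof.
pose G r j := \big[ai_add/F ord0 j]_(i <- r) F (lift ord0 i) j.
suff H r : \big[ai_add/ai_sum (F ord0)]_(i <- r) ai_sum (F (lift ord0 i)) =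
           ai_sum (G r) by exact: H.
elim: r => [|i r IH].
  by rewrite big_nil; apply: eq_ai_sum => j; rewrite /G big_nil.
rewrite big_cons IH -ai_sumDl.
by apply: eq_ai_sum => j; rewrite /G big_cons.
Qed.

End NonemptySum.

(* The n x n matrices, for n > 0.  As for {'GL_n[R]} in matrix.v, the dimension
   is n.-1.+1, so that n = 0 is a junk case denoting 1 x 1 matrices. *)
Definition ai_matrix (n : nat) (S : Type) : Type := 'M[S]_n.-1.+1.

Section Matrix.
Variables (n : nat) (S : aiSemiringType).
Implicit Types A B C : ai_matrix n S.

Definition ai_addmx A B : ai_matrix n S := \matrix_(i, j) (A i j + B i j).
Definition ai_mulmx A B : ai_matrix n S :=
  \matrix_(i, j) ai_sum (fun k => A i k * B k j).

Fact ai_matrix_inhabited : inhabited (ai_matrix n S).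
Proof. by case: (@ai_inhabited S) => x; exists; exact: const_mx. Qed.

Fact ai_addmxA : associative ai_addmx.
Proof. by move=> A B C; apply/matrixP => i j; rewrite !mxE ai_addA. Qed.

Fact ai_addmxC : commutative ai_addmx.
Proof. by move=> A B; apply/matrixP => i j; rewrite !mxE ai_addC. Qed.

Fact ai_addmxx : idempotent_op ai_addmx.
Proof. by move=> A; apply/matrixP => i j; rewrite !mxE ai_addxx. Qed.

Fact ai_mulmxA : associative ai_mulmx.
Proof.
move=> A B C; apply/matrixP => i j; rewrite !mxE.
under eq_ai_sum do rewrite mxE ai_mul_sumr.
rewrite ai_exchange_sum; apply: eq_ai_sum => k.
by rewrite mxE ai_mul_suml; apply: eq_ai_sum => l; rewrite ai_mulA.
Qed.

Fact ai_mulmxDr : right_distributive ai_mulmx ai_addmx.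
Proof.
move=> A B C; apply/matrixP => i j; rewrite !mxE -ai_sumDl.
by apply: eq_ai_sum => k; rewrite mxE ai_mulDr.
Qed.

Fact ai_mulmxDl : left_distributive ai_mulmx ai_addmx.
Proof.
move=> A B C; apply/matrixP => i j; rewrite !mxE -ai_sumDl.
by apply: eq_ai_sum => k; rewrite mxE ai_mulDl.
Qed.

HB.instance Definition _ := isAiSemiring.Build (ai_matrix n S)
  ai_matrix_inhabited ai_addmxA ai_addmxC ai_addmxx
  ai_mulmxA ai_mulmxDr ai_mulmxDl.

End Matrix.

Definition ai_prod (I : Type) (S : I -> aiSemiringType) : Type :=
  forall i, S i.

Section Product.
Variables (I : Type) (S : I -> aiSemiringType).
Implicit Types f g h : ai_prod S.

Definition ai_prod_add f g : ai_prod S := fun i => f i + g i.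
Definition ai_prod_mul f g : ai_prod S := fun i => f i * g i.

Fact ai_prod_inhabited : inhabited (ai_prod S).
Proof.
have H i : {x : S i | True}.
  by apply: cid; case: (@ai_inhabited (S i)) => x; exists x.
by exists => i; exact: (sval (H i)).
Qed.

Fact ai_prod_addA : associative ai_prod_add.
Proof. by move=> f g h; apply: functional_extensionality_dep => i; exact: ai_addA. Qed.

Fact ai_prod_addC : commutative ai_prod_add.
Proof. by move=> f g; apply: functional_extensionality_dep => i; exact: ai_addC. Qed.

Fact ai_prod_addxx : idempotent_op ai_prod_add.
Proof. by move=> f; apply: functional_extensionality_dep => i; exact: ai_addxx. Qed.

Fact ai_prod_mulA : associative ai_prod_mul.
Proof. by move=> f g h; apply: functional_extensionality_dep => i; exact: ai_mulA. Qed.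

Fact ai_prod_mulDr : right_distributive ai_prod_mul ai_prod_add.
Proof. by move=> f g h; apply: functional_extensionality_dep => i; exact: ai_mulDr. Qed.

Fact ai_prod_mulDl : left_distributive ai_prod_mul ai_prod_add.
Proof. by move=> f g h; apply: functional_extensionality_dep => i; exact: ai_mulDl. Qed.

HB.instance Definition _ := isAiSemiring.Build (ai_prod S)
  ai_prod_inhabited ai_prod_addA ai_prod_addC ai_prod_addxx
  ai_prod_mulA ai_prod_mulDr ai_prod_mulDl.

End Product.

(* [set aiSemiringType] of classical_sets.v is universe inconsistent with
   matrices as carriers, hence the bare predicates. *)
Definition ai_class := aiSemiringType -> Prop.

(* Subalgebras are taken up to isomorphism, as the domains of injective
   morphisms; closure under isomorphic copies is in any case part of closure
   under homomorphic images. *)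
Definition ai_variety (K : ai_class) : Prop :=
  [/\ forall (S T : aiSemiringType) (f : T -> S),
        ai_morphism f -> injective f -> K S -> K T,
      forall (S T : aiSemiringType) (f : S -> T),
        ai_morphism f -> (forall y, exists x, f x = y) -> K S -> K T
    & forall (I : Type) (S : I -> aiSemiringType),
        (forall i, K (S i)) -> K (ai_prod S : aiSemiringType)].

Definition ai_var (S : aiSemiringType) : ai_class :=
  fun T => forall K : ai_class, ai_variety K -> K S -> K T.

Definition ai_proper (W V : ai_class) : Prop :=
  (forall T, W T -> V T) /\ ~ (forall T, V T -> W T).

(* Main.v *)
Require Import Defs.
From mathcomp Require Import all_boot.
From mathcomp Require Import matrix boolp zify.

(** An n x n Boolean matrix A is a digraph on n vertices, and the entries of
    A^k record its walks of length k.  A walk of length n repeats a vertex;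
    going twice round the cycle so obtained gives a walk of length n + d with
    1 <= d <= n, so M_n(D2) satisfies x^n <= x^(n+1) + ... + x^(2n).  This
    fails in M_(n+1)(D2) for the adjacency matrix of a directed path, which is
    nilpotent of index n + 1.  The inclusions come from padding matrices with
    zeros. *)

Set Implicit Arguments.
Unset Strict Implicit.
Unset Printing Implicit Defensive.

Local Open Scope ai_scope.

Lemma ai_sum_morph (S T : aiSemiringType) (f : S -> T) m (F : 'I_m.+1 -> S) :
  {morph f : x y / x + y} -> f (ai_sum F) = ai_sum (fun k => f (F k)).
Proof. by move=> fD; exact: (big_morph f fD). Qed.

(* Semirings here have no unit, so the exponent is shifted: this is x^(k+1). *)
Definition ai_powS (S : aiSemiringType) (x : S) (k : nat) : S :=
  iter k (ai_mul x) x.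

Lemma ai_powS_morph (S T : aiSemiringType) (f : S -> T) x k :
  {morph f : x y / x * y} -> f (ai_powS x k) = ai_powS (f x) k.
Proof. by move=> fM; elim: k => //= k IH; rewrite fM IH. Qed.

(** With n = m + 1, the true exponents run from n + 1 (d = 0) to 2n (d = m). *)
Definition power_sum (S : aiSemiringType) (m : nat) (x : S) : S :=
  ai_sum (fun d : 'I_m.+1 => ai_powS x (m + d.+1)%N).

Lemma power_sum_morph (S T : aiSemiringType) (f : S -> T) m x :
  ai_morphism f -> f (power_sum m x) = power_sum m (f x).
Proof.
move=> [fD fM]; rewrite /power_sum ai_sum_morph //.
by apply: eq_ai_sum => d; exact: ai_powS_morph.
Qed.

(* For n = m + 1, the inequality x^n <= x^(n+1) + ... + x^(2n). *)
Definition power_identity (m : nat) : ai_class :=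
  fun S => forall x : S, ai_powS x m + power_sum m x = power_sum m x.

(** Morphisms commute with both sides of the identity; a product is checked through its
    projections. *)
Lemma power_identity_variety m : ai_variety (power_identity m).
Proof.
split=> [S T f fh f_inj idS x|S T f fh f_surj idS y|I S idS x].
- apply: f_inj; case: (fh) => fD fM.
  by rewrite fD ai_powS_morph // power_sum_morph.
- have [x <-] := f_surj y; case: (fh) => fD fM.
  by rewrite -ai_powS_morph // -power_sum_morph // -fD idS.
- apply: functional_extensionality_dep => i.
  have prh : ai_morphism (fun g : ai_prod S => g i) by [].
  rewrite -[LHS]/(ai_powS x m i + power_sum m x i).
  by rewrite (power_sum_morph _ _ prh) (ai_powS_morph _ _ (proj2 prh)) idS.
Qed.

(** Every variety containing [T] also contains its subalgebra [S]. *)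
Lemma ai_var_sub (S T : aiSemiringType) (f : S -> T) :
  ai_morphism f -> injective f -> forall U, ai_var S U -> ai_var T U.
Proof.
move=> fh f_inj U SU K varK KT; apply: SU => //.
by case: (varK) => sub _ _; exact: sub fh f_inj KT.
Qed.

Lemma ai_sum_D2P m (F : 'I_m.+1 -> D2) :
  reflect (exists k, F k) (ai_sum F : bool).
Proof.
have -> : ai_sum F = F ord0 || has (fun k => F (lift ord0 k)) (index_enum 'I_m).
  rewrite /ai_sum; elim: (index_enum _) => [|k r IH].
    by rewrite big_nil /= orbF.
  by rewrite big_cons IH /=; exact: orbCA.
apply: (iffP orP) => [[F0|/hasP[k _ Fk]]|[k]]; [by exists ord0|by eexists; eauto|].
case: (unliftP ord0 k) => [l|] -> Fk; [right|by left].
by apply/hasP; exists l; rewrite ?mem_index_enum.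
Qed.

Lemma ai_mul_D2E (a b : D2) : a * b = a && b.
Proof. by []. Qed.

Lemma ai_addmx_D2E n (A B : ai_matrix n D2) i j :
  (A + B) i j = A i j || B i j.
Proof. by rewrite [LHS]mxE. Qed.

Lemma ai_mulmx_D2P n (A B : ai_matrix n D2) i j :
  reflect (exists2 k, A i k & B k j) ((A * B) i j : bool).
Proof.
rewrite [X in reflect _ X]mxE.
apply: (iffP (ai_sum_D2P _)) => [[k]|[k Ak Bk]]; last first.
  by exists k; rewrite ai_mul_D2E Ak Bk.
by rewrite ai_mul_D2E => /andP[]; exists k.
Qed.

Lemma power_sum_D2P n m (A : ai_matrix n D2) i j :
  reflect (exists2 d, (d < m.+1)%N & ai_powS A (m + d.+1)%N i j)
          (power_sum m A i j : bool).
Proof.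
rewrite /power_sum (ai_sum_morph (f := fun B : ai_matrix n D2 => B i j)); last first.
  by move=> B C; exact: ai_addmx_D2E.
apply: (iffP (ai_sum_D2P _)) => [[d Ad]|[d ltd Ad]]; first by exists d.
by exists (Ordinal ltd).
Qed.

(** The list [p] omits the starting vertex [i], so its size is the number of edges, which is the
    true exponent. *)
Lemma ai_powS_walkP n (A : ai_matrix n D2) k i j :
  reflect (exists p, [/\ path (fun u v => A u v) i p, size p = k.+1
                       & last i p = j])
          (ai_powS A k i j : bool).
Proof.
elim: k i => [|k IH] i /=.
  apply: (iffP idP) => [Aij|[[|u [|v p]] [//= pp //= _ <-]]].
    by exists [:: j]; rewrite /= Aij.
  by case/andP: pp.
apply: (iffP (ai_mulmx_D2P _ _ _ _)) => [[u Aiu /IH[p [pp sp lp]]]|].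
  by exists (u :: p); rewrite /= Aiu pp sp.
case=> [[|u p] [] //= /andP[Aiu pp] [sp] lp].
by exists u => //; apply/IH; exists p.
Qed.

(* Among the vertices of a walk p from i, those of positions a < b coincide;
   take b p ++ drop a p goes twice round the cycle between them. *)
Lemma power_identity_matrix m : power_identity m (ai_matrix m.+1 D2).
Proof.
move=> A; apply/matrixP => i j; rewrite ai_addmx_D2E.
apply/orb_idl => /ai_powS_walkP[p [pp sp lp]].
(* Pigeonhole: [i :: p] has m + 2 entries among m + 1 vertices. *)
have /uniqPn-/(_ i)[a [b [ltab ltb eqab]]] : ~~ uniq (i :: p).
  apply/negP => /card_uniqP card_p.
  by have := max_card (mem (i :: p)); rewrite card_p card_ord /= sp ltnn.
rewrite /= sp in ltb.
have last_take c : (c <= size p)%N -> last i (take c p) = nth i (i :: p) c.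
  by case: c => [|c] lec; rewrite ?take0 // (last_nth i) size_takel //= nth_take.
have := pp; rewrite -{1}(cat_take_drop a p) cat_path => /andP[_ ppa].
have lpa : last (last i (take a p)) (drop a p) = j.
  by rewrite -last_cat cat_take_drop.
(* The second round adds b - a edges to m + 1, and the term of index d has true exponent m + 1 + (d
   + 1). *)
apply/power_sum_D2P; exists (b - a).-1; first lia.
apply/ai_powS_walkP; exists (take b p ++ drop a p).
(* The two pieces join because positions a and b carry the same vertex. *)
rewrite cat_path last_cat take_path //= (last_take b) -?eqab -?last_take; try lia.
by split=> //; rewrite size_cat size_takel ?size_drop sp; lia.
Qed.

Definition shift_mx (n : nat) : ai_matrix n D2 :=
  (\matrix_(i, j) (j == i.+1 :> nat))%R.

Lemma ai_powS_shiftE n k i j :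
  ai_powS (shift_mx n) k i j = (j == (i + k.+1)%N :> nat) :> bool.
Proof.
elim: k i => [|k IH] i /=; first by rewrite mxE addn1.
apply/ai_mulmx_D2P/eqP => [[u]|ji]; first by rewrite mxE IH => /eqP-> /eqP->; lia.
have ltu : (i.+1 < n.-1.+1)%N by have := ltn_ord j; lia.
by exists (Ordinal ltu); rewrite ?mxE ?IH //=; apply/eqP; lia.
Qed.

(** From the first to the last vertex of the directed path the only walk has length m + 1, so only
    the left side has a 1 at this entry. *)
Lemma power_identity_matrixS m : ~ power_identity m (ai_matrix m.+2 D2).
Proof.
move=> /(_ (shift_mx m.+2)) /matrixP /(_ ord0 ord_max).
rewrite ai_addmx_D2E ai_powS_shiftE /= eqxx => /esym/power_sum_D2P[d _].
by rewrite ai_powS_shiftE => /eqP /=; lia.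
Qed.

Lemma ai_var_matrixS_neq m :
  ~ (forall T, ai_var (ai_matrix m.+2 D2) T -> ai_var (ai_matrix m.+1 D2) T).
Proof.
move=> /(_ (ai_matrix m.+2 D2)) sub; apply: (@power_identity_matrixS m).
have self : ai_var (ai_matrix m.+2 D2) (ai_matrix m.+2 D2) by move=> K.
exact: (sub self _ (power_identity_variety m) (@power_identity_matrix m)).
Qed.

(** Each entry of a product of constant matrices is a nonempty sum of equal terms, which idempotence
    collapses. *)
Lemma const_mx_morphism n :
  ai_morphism (fun a : D2 => const_mx a : ai_matrix n D2).
Proof.
split=> a b; apply/matrixP => i j; first by rewrite ai_addmx_D2E !mxE.
rewrite mxE; apply/idP/ai_mulmx_D2P => [/andP[a1 b1]|[k]].
  by exists ord0; rewrite mxE.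
by rewrite !mxE => a1 b1; apply/andP.
Qed.

Lemma const_mx_inj n :
  injective (fun a : D2 => const_mx a : ai_matrix n D2).
Proof. by move=> a b /matrixP/(_ ord0 ord0); rewrite !mxE. Qed.

(** The block matrix diag(A, 0); the bounds mask the default value of [inord]. *)
Definition pad_mx m (A : ai_matrix m.+1 D2) : ai_matrix m.+2 D2 :=
  (\matrix_(i, j) [&& i < m.+1, j < m.+1 & A (inord i) (inord j)])%R.

Lemma pad_mx_morphism m : ai_morphism (@pad_mx m).
Proof.
split=> A B; apply/matrixP => i j.
  rewrite ai_addmx_D2E !(mxE, ai_addmx_D2E).
  by case: (i < _)%N; case: (j < _)%N.
rewrite mxE; apply/and3P/ai_mulmx_D2P => [[lti ltj /ai_mulmx_D2P[k Ak Bk]]|[k]].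
  have ltk := ltn_ord k.
  by exists (inord k); rewrite mxE inordK ?(leqW ltk) // inord_val; apply/and3P.
(* The added index has zero row and column, so [k] lies in the original range. *)
rewrite [pad_mx A i k]mxE [pad_mx B k j]mxE => /and3P[lti ltk Ak] /and3P[_ ltj Bk].
by split=> //; apply/ai_mulmx_D2P; exists (inord k).
Qed.

Lemma pad_mx_inj m : injective (@pad_mx m).
Proof.
move=> A B /matrixP AB; apply/matrixP => i j.
have [lti ltj] := (ltn_ord i, ltn_ord j).
have := AB (inord i) (inord j).
by rewrite !mxE !inordK ?(leqW lti) ?(leqW ltj) // !inord_val lti ltj.
Qed.

Theorem proposition2p7 :
  ai_proper (ai_var D2) (ai_var (ai_matrix 2 D2)) /\
  (forall n : nat, 2 <= n ->
     ai_proper (ai_var (ai_matrix n D2)) (ai_var (ai_matrix n.+1 D2))).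
Proof.
split=> [|[//|m] _].
  split; first exact: ai_var_sub (const_mx_morphism 2) (@const_mx_inj 2).
  (* [D2] embeds into the 1 x 1 matrices, so x <= x^2 separates it from the 2 x 2 ones. *)
  move=> sub; apply: (@ai_var_matrixS_neq 0) => T /sub.
  exact: ai_var_sub (const_mx_morphism 1) (@const_mx_inj 1) T.
split; last exact: ai_var_matrixS_neq.
exact: ai_var_sub (@pad_mx_morphism m) (@pad_mx_inj m).
Qed.
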